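(* Let $n\ge 5$ be an integer and let $\kappa, f, d$ be positive integers satisfying $d+f+1=n+2-\kappa$. Then there exists a connected non-complete graph $G$ on the vertex set $[n]=\{1,\dots,n\}$ with $f(G)=f$, $d(G)=d$ and $\kappa(G)=\kappa$ if and only if one of the following conditions holds: (1) $\kappa=1$, $f\ge 2$ and $d\ge 2$; (2) $\kappa=2$, $f\ge 2$ and $d\in\{2,3\}$; (3) $\kappa\ge 3$, $f\ge 2$ and $d=2$.
   Context: All graphs are finite and simple. For a connected graph $G$: $\operatorname{dist}_G(i,j)$ is the number of edges in a shortest path from $i$ to $j$, and $d(G)=\max\{\operatorname{dist}_G(i,j): i,j\in V(G)\}$ is the diameter. A vertex is simplicial if it is contained in exactly one maximal clique (equivalently, its neighbors are pairwise adjacent); $f(G)$ is the number of simplicial vertices of $G$. For non-complete $G$, the vertex connectivity is $\kappa(G)=\min\{|T| : T\subset V(G),\ \text{the induced subgraph on } V(G)\setminus T \text{ is disconnected}\}$. *)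

(* Defs.v *)
From mathcomp Require Import all_boot.

Set Implicit Arguments.
Unset Strict Implicit.
Unset Printing Implicit Defensive.

Record sgraph (V : finType) := SGraph {
  adj :> rel V;
  adj_sym : symmetric adj;
  adj_irrefl : irreflexive adj
}.

Section SimpleGraphs.

Variables (V : finType) (G : sgraph V).

(* The induced subgraph on S is kept on the type V; only the vertices in S
   are relevant, so its connectedness is tested on S alone. *)
Definition induced (S : {set V}) : rel V :=
  [rel x y | [&& x \in S, y \in S & G x y]].

Definition connected_on (S : {set V}) : bool :=
  [forall x in S, forall y in S, connect (induced S) x y].

Definition connected : bool := connected_on [set: V].

Definition complete : bool := [forall x, forall y, (x != y) ==> G x y].

(* A path with k edges from x to y; p lists its vertices other than x. *)
Definition has_path (x y : V) (k : nat) : bool :=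
  [exists p : k.-tuple V, [&& path G x p, uniq (x :: p) & last x p == y]].

(* A path has fewer than #|V| edges, so the search below is exhaustive; the
   value is #|V| when there is no path from x to y. *)
Definition dist (x y : V) : nat := find (has_path x y) (iota 0 #|V|).

Definition diameter : nat := \max_(x : V) \max_(y : V) dist x y.

Definition clique (A : {set V}) : bool :=
  [forall x in A, forall y in A, (x != y) ==> G x y].

Definition simplicial (v : V) : bool :=
  #|[set A : {set V} | maxset clique A & v \in A]| == 1.

Definition num_simplicial : nat := #|[set v | simplicial v]|.

(* The default #|V| is the value only when no set T separates, i.e. when G is
   complete: otherwise the complement of two non-adjacent vertices does, and
   separating sets are proper subsets of V. *)
Definition vertex_connectivity : nat :=
  \big[minn/#|V|]_(T : {set V} | ~~ connected_on (~: T)) #|T|.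

End SimpleGraphs.

(* Main.v *)
Require Import Defs.
From mathcomp Require Import all_boot.
From mathcomp Require Import zify.

Set Implicit Arguments.
Unset Strict Implicit.
Unset Printing Implicit Defensive.

(** Write kappa, f, d for the connectivity, the number of simplicial vertices
    and the diameter of a graph on n vertices; the hypothesis on the sum reads
    n = d + f + kappa - 1.

    Necessity. Take x and y at distance d. For 0 < i < d the vertices at
    distance i from x separate x from y. They still do once the simplicial
    ones among them are dropped, since a walk can bypass any simplicial vertex
    in its interior; hence at least kappa nonsimplicial vertices lie at
    distance i ([connectivity_le_layer]). Counting nonsimplicial vertices by
    their distance from x gives n - f >= kappa (d - 1), with an additional unit
    for each of x, y that is not simplicial ([layer_bound]). Substituting n,
    this says that (kappa - 1) (d - 2) is at most 1 minus the number of
    nonsimplicial ends; this is the required restriction on kappa and d.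
    If f = 1, exactly one end, say x, is simplicial, so (kappa - 1) (d - 2) = 0
    and every layer count is tight. Then all neighbours of y are at distance
    d - 1 from x. They are pairwise adjacent, because they are neighbours of
    the simplicial vertex x when d = 2, and because there is only one of them
    when kappa = 1. So y is simplicial after all, a contradiction
    ([extremal_parameters]).

    Sufficiency. Place the vertices on a line by a nondecreasing integer
    position whose increments are at most 1, and join two vertices when their
    positions differ by at most r. When the line is longer than r and the
    positions 1, ..., r are occupied once each, this graph has connectivity r;
    its diameter is the length of the line divided by r, rounded up, and its
    simplicial vertices are those at the two ends. Taking r = kappa, with f - 1 vertices at position 0 and
    one at every other position, settles kappa >= 2. For kappa = 1 and d >= 3
    the last position but one is doubled. The remaining case kappa = 1, d = 2
    needs a vertex adjacent to all others, and is settled by joining such a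
    vertex to the disjoint union of a star and an isolated vertex. *)

(** * Distance, simplicial vertices and separating sets *)

Section Graph.

Variables (V : finType) (G : sgraph V).

Implicit Types (x y z v w : V) (p : seq V) (S T : {set V}).

Lemma has_pathP x y k :
  reflect (exists p, [/\ size p = k, path G x p, uniq (x :: p) & last x p = y])
          (has_path G x y k).
Proof.
apply: (iffP existsP) => [[p /and3P[pth uq /eqP lst]] | [p [sz pth uq lst]]].
  by exists p; rewrite size_tuple.
have szP : size p == k by apply/eqP.
by exists (Tuple szP); rewrite /= pth lst eqxx andbT; exact: uq.
Qed.

Lemma size_uniq_lt x p : uniq (x :: p) -> size p < #|V|.
Proof. by move=> /card_uniqP /= <-; exact: max_card. Qed.

Lemma dist_le_size x p : path G x p -> dist G x (last x p) <= size p.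
Proof.
case/shortenP=> q pth uq sub.
have szq : size q <= size p by apply: uniq_leq_size => //; case/andP: uq.
apply: leq_trans szq; rewrite leqNgt; apply/negP => lt_q.
have q_lt : size q < #|V| by exact: size_uniq_lt uq.
have := before_find 0 lt_q; rewrite nth_iota // add0n => /negbT/negP[].
by apply/has_pathP; exists q.
Qed.

Lemma dist_path x y : connect G x y ->
  exists p, [/\ path G x p, last x p = y & size p = dist G x y].
Proof.
case/connectP=> _ /shortenP[p pth uq _] ->.
have p_lt : size p < #|V| by exact: size_uniq_lt uq.
have ex : has (has_path G x (last x p)) (iota 0 #|V|).
  apply/hasP; exists (size p); first by rewrite mem_iota.
  by apply/has_pathP; exists p.
have := nth_find 0 ex; rewrite nth_iota.
  2: by rewrite -[X in _ < X](size_iota 0) -has_find.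
by case/has_pathP=> q [sz qth _ lst]; exists q.
Qed.

Lemma connectedP : reflect (forall x y, connect G x y) (connected G).
Proof.
have same : induced G setT =2 G by move=> x y; rewrite /induced /= !in_setT.
apply: (iffP forall_inP) => [conn x y | conn x _].
  by rewrite -(eq_connect same); have /forall_inP := conn x (in_setT x); exact.
by apply/forall_inP=> y _; rewrite (eq_connect same).
Qed.

Lemma distxx x : dist G x x = 0.
Proof. by apply/eqP; rewrite -leqn0; exact: (@dist_le_size x [::]). Qed.

Lemma dist_le_diameter x y : dist G x y <= diameter G.
Proof.
apply: leq_trans (leq_bigmax x).
exact: (leq_bigmax (F := fun y => dist G x y) y).
Qed.

Lemma diameter_attained : 0 < #|V| -> exists x y, dist G x y = diameter G.
Proof.
move=> V_gt0.
have [x xP] := eq_bigmax (fun x => \max_y dist G x y) V_gt0.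
have [y yP] := eq_bigmax (fun y => dist G x y) V_gt0.
by exists x, y; rewrite /diameter xP yP.
Qed.

(** Both definitions of simplicial agree: two nonadjacent neighbours of [v]
    extend, together with [v], to different maximal cliques, whereas if there
    are no such neighbours then the closed neighbourhood of [v] is a clique
    that absorbs every clique through [v]. *)
Lemma simplicialP v :
  reflect (forall x y, G v x -> G v y -> x != y -> G x y) (simplicial G v).
Proof.
have cliqueP (A : {set V}) :
    reflect {in A &, forall x y, x != y -> G x y} (clique G A).
  apply: (iffP forall_inP) => [cl x y xA yA | cl x xA].
    by have /forall_inP/(_ y yA)/implyP := cl x xA.
  by apply/forall_inP => y yA; apply/implyP; exact: cl.
have edge_clique x : G v x -> clique G [set v; x].
  move=> vx; apply/cliqueP => a b; rewrite !inE.
  by move=> /orP[]/eqP-> /orP[]/eqP->; rewrite ?eqxx // adj_sym.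
apply: (iffP idP) => [/cards1P[M MP] x y vx vy nxy | nbr].
  have [A maxA /subsetP subA] := maxset_exists (edge_clique x vx).
  have [B maxB /subsetP subB] := maxset_exists (edge_clique y vy).
  have AM : A \in [set A | maxset (clique G) A & v \in A].
    by rewrite inE maxA subA // !inE eqxx.
  have BM : B \in [set A | maxset (clique G) A & v \in A].
    by rewrite inE maxB subB // !inE eqxx.
  move: AM BM; rewrite MP !inE => /eqP eqA /eqP eqB.
  have xA : x \in A by apply: subA; rewrite !inE eqxx orbT.
  have yA : y \in A by rewrite eqA -eqB subB // !inE eqxx orbT.
  exact: (cliqueP _ (maxsetp maxA)).
pose N := v |: [set x | G v x].
have clN : clique G N.
  apply/cliqueP => a b; rewrite !inE.
  move=> /orP[/eqP->|va] /orP[/eqP->|vb]; rewrite ?eqxx //; last exact: nbr.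
  by rewrite adj_sym.
have subN A : clique G A -> v \in A -> A \subset N.
  move=> /cliqueP clA vA; apply/subsetP => x xA; rewrite !inE.
  by have [//|nxv] := eqVneq x v; rewrite clA // eq_sym.
apply/cards1P; exists N; apply/setP=> A; rewrite !inE.
apply/andP/eqP => [[maxA vA] | ->].
  by have [clA /(_ N clN (subN A clA vA))] := maxsetP maxA.
rewrite !inE eqxx; split=> //; apply/maxsetP; split=> // B clB NB.
apply/eqP; rewrite eqEsubset NB andbT; apply: subN => //.
by apply: (subsetP NB); rewrite !inE eqxx.
Qed.

Lemma connectivity_le S x y : x \notin S -> y \notin S ->
  ~~ connect (induced G (~: S)) x y -> vertex_connectivity G <= #|S|.
Proof.
move=> xS yS nxy; rewrite /vertex_connectivity.
have sepS : ~~ connected_on G (~: S).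
  apply: contra nxy => /forall_inP/(_ x); rewrite inE xS => /(_ isT).
  by move=> /forall_inP/(_ y); rewrite inE yS => /(_ isT).
elim: (index_enum _) (mem_index_enum S) => // T r IH.
rewrite in_cons big_cons => /orP[/eqP<-|/IH le_r]; first by rewrite sepS geq_minl.
by case: ifP => // _; rewrite geq_min le_r orbT.
Qed.

Lemma le_connectivity k : k <= #|V| ->
  (forall S x y, #|S| < k -> x \notin S -> y \notin S ->
     connect (induced G (~: S)) x y) -> k <= vertex_connectivity G.
Proof.
move=> kV conn; rewrite /vertex_connectivity.
elim/big_ind: _ => // [a b ka kb | S]; first by rewrite leq_min ka.
rewrite leqNgt; apply: contra => lt_S; apply/forall_inP => x xS.
by apply/forall_inP => y yS; apply: conn => //; rewrite -in_setC.
Qed.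

(** A walk inside [S] can be shortened at any simplicial interior vertex, since
    the two neighbours of that vertex on the walk are equal or adjacent. *)
Lemma nonsimplicial_path S x y : connect (induced G S) x y ->
  exists p, [/\ path (induced G S) x p, last x p = y
              & {in p, forall z, z != y -> ~~ simplicial G z}].
Proof.
case/connectP=> p pth ->.
have [k] := ubnP (size p); elim: k p pth => // k IH p pth.
rewrite ltnS => szp.
have [/hasP[z zp /andP[nz sz]] | /hasPn nsimp] :=
    boolP (has [pred z | (z != last x p) && simplicial G z] p); last first.
  by exists p; split=> // z zp nz; have /= := nsimp z zp; rewrite nz.
case/splitPr: zp pth nz szp => p1 [|b p2].
  by rewrite last_cat /= eqxx.
rewrite cat_path last_cat size_cat /= => /and4P[p1P az zb p2P] _ szp.
have [q [qP qlst qsz]] : exists q, [/\ path (induced G S) x q,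
    last x q = last b p2 & size q < k].
  have [eab|nab] := eqVneq (last x p1) b.
    exists (p1 ++ p2); rewrite cat_path last_cat size_cat p1P eab.
    by split=> //; lia.
  exists (p1 ++ b :: p2); rewrite cat_path last_cat size_cat /= p1P p2P.
  case/and3P: az zb => aS zS az /and3P[_ bS zb].
  rewrite /induced /= aS bS; split=> //; last by lia.
  rewrite andbT; apply: (simplicialP _ sz) => //.
  by rewrite adj_sym.
by have := IH q qP qsz; rewrite qlst.
Qed.

(** * Layers of a diametral pair *)

Hypothesis conn : connected G.

Lemma dist_adj x y z : G y z -> dist G x z <= (dist G x y).+1.
Proof.
move=> yz; have [p [pth lst <-]] := dist_path (connectedP conn x y).
rewrite -(size_rcons p z) -[X in dist _ _ X](last_rcons x p z).
by apply: dist_le_size; rewrite rcons_path pth lst.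
Qed.

Lemma dist_sym x y : dist G x y = dist G y x.
Proof.
suff le u v : dist G u v <= dist G v u by apply/eqP; rewrite eqn_leq !le.
have [p [pth lst <-]] := dist_path (connectedP conn v u).
have := rev_path G v p; rewrite lst.
rewrite (eq_path (e' := G)); last by move=> a b; rewrite adj_sym.
rewrite pth => /dist_le_size; rewrite size_rev size_belast.
case: p {pth} lst => [/= -> //|a p] lst.
by rewrite /= rev_cons last_rcons.
Qed.

Lemma dist_eq0 x y : (dist G x y == 0) = (x == y).
Proof.
apply/eqP/eqP => [|->]; last exact: distxx.
by have [[|? ?] [_ <- <-]] := dist_path (connectedP conn x y).
Qed.

Lemma dist_eq1 x y : (dist G x y == 1) = G x y.
Proof.
apply/eqP/idP => [|xy].
  have [[|z [|? ?]] [pth <- <-]] //= := dist_path (connectedP conn x y).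
  by case/andP: pth.
apply/eqP; rewrite eqn_leq lt0n dist_eq0 (@dist_le_size x [:: y]) /= ?xy //.
by apply: contraTneq xy => ->; rewrite adj_irrefl.
Qed.

(** A discrete intermediate value theorem: the distance from [o] grows by at
    most one along an edge. *)
Lemma dist_onto_path o x p i : path G x p ->
  dist G o x <= i <= dist G o (last x p) ->
  exists2 z, z \in x :: p & dist G o z = i.
Proof.
elim: p x => [|y p IH] x /=.
  by move=> _ /anti_leq <-; exists x; rewrite ?mem_head.
case/andP=> xy pth /andP[]; rewrite leq_eqVlt => /orP[/eqP<- _|lti le_i].
  by exists x; rewrite ?mem_head.
have [|z zp <-] := IH y pth; last by exists z; rewrite // in_cons zp orbT.
by rewrite le_i (leq_trans (dist_adj o xy)).
Qed.

Definition nonsimplicial_layer x i :=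
  [set v | (dist G x v == i) && ~~ simplicial G v].

(** The nonsimplicial part of an intermediate layer separates [x] from [y]:
    otherwise [x] and [y] would be joined outside it by a path with
    nonsimplicial interior, and that path meets the layer. *)
Lemma connectivity_le_layer x y i : 0 < i < dist G x y ->
  vertex_connectivity G <= #|nonsimplicial_layer x i|.
Proof.
move=> /andP[i0 iy]; apply: (@connectivity_le _ x y).
- by rewrite inE distxx; move: i0; case: i {iy}.
- by rewrite inE gtn_eqF.
apply/negP => /nonsimplicial_path[p [pth lst nsimp]].
have pG : path G x p by apply: sub_path pth => a b /and3P[].
have [|z zp zi] := dist_onto_path (i := i) (o := x) pG.
  by rewrite distxx lst (ltnW iy).
have {}zp : z \in p.
  by move: zp; rewrite in_cons => /orP[/eqP ez|//]; rewrite ez distxx in zi; lia.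
have nzy : z != y by apply: contraTneq iy => <-; rewrite zi ltnn.
have : z \in nonsimplicial_layer x i by rewrite inE zi eqxx nsimp.
apply/negP; rewrite -in_setC.
case/splitPr: zp pth => p1 p2; rewrite cat_path /=.
by case/and3P => _ /and3P[].
Qed.

(** The nonsimplicial vertices are counted by their distance from [x]. The last
    interior layer is not replaced by its lower bound, because when
    kappa = 1 the tightness of that layer matters. *)
Lemma layer_bound x y : 2 <= dist G x y -> dist G x y = diameter G ->
  #|nonsimplicial_layer x 0| + vertex_connectivity G * (diameter G - 2)
   + #|nonsimplicial_layer x (diameter G).-1|
   + #|nonsimplicial_layer x (diameter G)| + num_simplicial G <= #|V|.
Proof.
move=> d2 dE; rewrite -(cardsC [set v | simplicial G v]) /num_simplicial.
rewrite [X in _ <= X]addnC leq_add2r.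
have -> : #|~: [set v | simplicial G v]|
    = \sum_(0 <= i < (diameter G).+1) #|nonsimplicial_layer x i|.
  rewrite -sum1_card (partition_big
    (fun v => Ordinal (dist_le_diameter x v : _ < (diameter G).+1)) predT) //=.
  rewrite big_mkord; apply: eq_bigr => i _; rewrite -sum1_card.
  by apply: eq_bigl => v; rewrite !inE -val_eqE /= andbC.
rewrite -dE; case: (dist G x y) d2 (@connectivity_le_layer x y) => [|[|d]] // _ sep.
rewrite big_nat_recr // big_nat_recr // big_nat_recl //= subn2 /=.
rewrite !leq_add2r leq_add2l mulnC -[d in d * _]subn0 -sum_nat_const_nat.
rewrite big_nat [X in _ <= X]big_nat; apply: leq_sum => i /andP[_ lt_id].
by apply: sep; lia.
Qed.

Lemma diameter_ge2 : ~~ complete G -> 2 <= diameter G.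
Proof.
move=> /forallPn[x /forallPn[y]]; rewrite negb_imply -dist_eq1 => /andP[].
by have := dist_le_diameter x y; rewrite -dist_eq0; lia.
Qed.

(** The layer count has a slack of 1 - (kappa - 1) (d - 2), and each
    nonsimplicial end of the diametral pair uses up one unit of it. With a
    single simplicial vertex at one end, nothing is left that could make the
    other end nonsimplicial. *)
Theorem extremal_parameters : ~~ complete G -> 0 < vertex_connectivity G ->
    0 < num_simplicial G ->
    diameter G + num_simplicial G + vertex_connectivity G = #|V|.+1 ->
  2 <= num_simplicial G /\
    (vertex_connectivity G).-1 * (diameter G - 2) <= 1.
Proof.
move=> /diameter_ge2 d2 k0 f0 sumE.
have [|x [y xyE]] := diameter_attained; first by lia.
set k := vertex_connectivity G in k0 sumE *.
set d := diameter G in d2 sumE xyE *.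
set f := num_simplicial G in f0 sumE *.
have sep a b : dist G a b = d -> k <= #|nonsimplicial_layer a d.-1|.
  by move=> abE; apply: (@connectivity_le_layer a b); lia.
have bound a b : dist G a b = d ->
    #|nonsimplicial_layer a 0| + #|nonsimplicial_layer a d.-1|
      + #|nonsimplicial_layer a d| + k * (d - 2) <= d + k - 1.
  move=> abE; have := @layer_bound a b; rewrite -/k -/d -/f abE.
  by move=> /(_ d2 erefl); lia.
split; last first.
  have := bound x y xyE; have := sep x y xyE; nia.
rewrite ltnNge; apply/negP => f1.
have simp1 a b : simplicial G a -> simplicial G b -> a = b.
  move=> sa sb; move: f1; rewrite /f /num_simplicial.
  by move/card_le1_eqP; apply; rewrite inE.
(* Not both ends are simplicial, and the pair can be reversed. *)
wlog ny: x y xyE / ~~ simplicial G y.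
  move=> wlg; have [sy|] := boolP (simplicial G y); last exact: wlg xyE.
  apply: (wlg y x); first by rewrite dist_sym.
  apply/negP => sx; move: xyE; rewrite (simp1 x y sx sy) distxx; lia.
have yL : y \in nonsimplicial_layer x d by rewrite inE xyE eqxx.
have d_card : 0 < #|nonsimplicial_layer x d| by apply/card_gt0P; exists y.
have bnd := bound x y xyE; have sp := sep x y xyE.
(* From here on the nonsimplicial end [y] uses up the slack of the count. *)
have d_card1 : #|nonsimplicial_layer x d| <= 1 by nia.
have sx : simplicial G x.
  apply: contraT => nx; have : 0 < #|nonsimplicial_layer x 0|.
    by apply/card_gt0P; exists x; rewrite inE distxx nx.
  by nia.
have only_x z : z != x -> ~~ simplicial G z.
  by apply: contra => sz; rewrite (simp1 z x).
have nbr z : G y z -> dist G x z = d.-1.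
  move=> yz; have := dist_adj x yz; have := dist_le_diameter x z.
  rewrite -/d; have : d <= (dist G x z).+1.
    by rewrite -xyE; apply: dist_adj; rewrite adj_sym.
  have [zd _ _ _|] := eqVneq (dist G x z) d; last by rewrite xyE; lia.
  have zL : z \in nonsimplicial_layer x d.
    rewrite inE zd eqxx only_x //; apply: contraTneq d2 => zx.
    by rewrite -zd zx distxx.
  by rewrite (card_le1_eqP d_card1 z y zL yL) adj_irrefl in yz.
case/negP: ny; apply/simplicialP => a b /nbr da /nbr db.
have [d_eq2|d_neq2] := eqVneq d 2.
  by apply: (simplicialP _ sx); rewrite -dist_eq1; lia.
have k1 : k = 1 by nia.
have L1 : #|nonsimplicial_layer x d.-1| <= 1 by nia.
have inL z : dist G x z = d.-1 -> z \in nonsimplicial_layer x d.-1.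
  by move=> zd; rewrite inE zd eqxx only_x // -dist_eq0 dist_sym zd; lia.
by rewrite (card_le1_eqP L1 a b (inL a da) (inL b db)) eqxx.
Qed.

End Graph.

(** * Proximity graphs *)

Lemma card_ord_interval n a b (A : {set 'I_n}) : b <= n ->
  (forall v, (v \in A) = (a <= v < b)) -> #|A| = b - a.
Proof.
move=> le_bn AE; rewrite -sum1_card (eq_bigl _ _ AE).
rewrite -(big_mkord (fun v => a <= v < b) (fun=> 1)).
rewrite -[RHS]muln1 -sum_nat_const_nat (big_nat_widen _ _ _ _ _ le_bn).
rewrite (big_nat_widenl _ _ _ _ _ (leq0n a)).
by apply: eq_bigl => v; rewrite andbC.
Qed.

Section Proximity.

Variables (n r : nat) (pos : nat -> nat).

(** When the positions increase by at most one, this is the [r]-th power of a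
    path in which vertices may be replaced by cliques of twins, namely vertices
    sharing a position. *)
Definition proximity : rel 'I_n.+1 :=
  [rel u v : 'I_n.+1 | [&& u != v, pos u <= pos v + r & pos v <= pos u + r]].

Lemma proximity_sym : symmetric proximity.
Proof.
by move=> u v; rewrite /proximity /= eq_sym; congr (_ && _); rewrite andbC.
Qed.

Lemma proximity_irrefl : irreflexive proximity.
Proof. by move=> u; rewrite /proximity /= eqxx. Qed.

Definition proximity_graph := SGraph proximity_sym proximity_irrefl.

Local Notation G := proximity_graph.
Local Notation m := (pos n).

Hypothesis pos0 : pos 0 = 0.
Hypothesis pos_step : forall v, pos v <= pos v.+1 <= (pos v).+1.
Hypothesis r_gt0 : 0 < r.
Hypothesis r_lt : r < m.

Implicit Types u v w : 'I_n.+1.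

Lemma pos_bounds (u v : nat) : u <= v -> pos u <= pos v <= pos u + (v - u).
Proof.
move=> /subnK <-; elim: (v - u) => [|k IH]; first by rewrite leqnn leq_addr.
by rewrite addSn; have := pos_step (k + u); lia.
Qed.

Lemma pos_onto j : j <= m -> exists v : 'I_n.+1, pos v = j.
Proof.
suff onto (k : nat) : k < n.+1 -> j <= pos k -> exists v : 'I_n.+1, pos v = j.
  exact: onto (ltnSn n).
elim: k => [|k IH] k_lt le_j; first by exists ord0 => /=; lia.
have [/IH|lt_j] := leqP j (pos k); first by apply; lia.
by exists (Ordinal k_lt); rewrite /=; have := pos_step k; lia.
Qed.

Lemma pos_path u p : path G u p -> pos (last u p) <= pos u + r * size p.
Proof.
elim: p u => [|v p IH] u /=; first by rewrite muln0 addn0.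
case/andP => /and3P[_ _ uv] /IH le_p; apply: leq_trans le_p _.
by rewrite mulnS addnA leq_add2r.
Qed.

(** Greedy jumps of length exactly [r] suffice. The bound is [k.+1] because
    two distinct vertices at the same position still need an edge. *)
Lemma proximity_path k u v : u <= v -> pos v <= pos u + r * k.+1 ->
  exists p, [/\ path G u p, last u p = v & size p <= k.+1].
Proof.
have direct u' : u' <= v -> pos v <= pos u' + r ->
    exists p, [/\ path G u' p, last u' p = v & size p <= 1].
  move=> le_uv near; have [->|nuv] := eqVneq u' v; first by exists [::].
  exists [:: v]; split=> //=; rewrite /proximity /= nuv near.
  by have := pos_bounds le_uv; lia.
elim: k u => [|k IH] u le_uv reach; first by apply: direct; lia.
have [/(direct u le_uv)[p [pth lst sz]]|far] := leqP (pos v) (pos u + r).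
  by exists p; split=> //; lia.
have [|w wE] := @pos_onto (pos u + r).
  by have := @pos_bounds v n; have := ltn_ord v; lia.
have lt_wv : w < v.
  by rewrite ltnNge; apply/negP => /pos_bounds; lia.
have [||p [pth lst sz]] := IH w; [lia | lia |].
exists (w :: p); split=> //=; rewrite pth andbT /proximity /= wE.
apply/and3P; split; [|lia|lia].
by apply/eqP => uw; rewrite -uw in wE; lia.
Qed.

Lemma proximity_connected : connected G.
Proof.
apply/connectedP => u v.
wlog le_uv : u v / u <= v.
  have cs : connect_sym G by apply: sym_connect_sym; exact: proximity_sym.
  by move=> wlg; case: (leqP u v) => [/wlg//|/ltnW/wlg]; rewrite cs.
have [|p [pth lst _]] := @proximity_path (pos v) u v le_uv; first by nia.
by apply/connectP; exists p.
Qed.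

(** A path with k edges advances by at most r k, so joining the two ends takes
    at least m / r edges, rounded up; greedy jumps never take more. *)
Lemma proximity_diameter d : 0 < d -> r * d.-1 < m <= r * d -> diameter G = d.
Proof.
move=> d_gt0 /andP[lt_m le_m]; apply/eqP; rewrite eqn_leq; apply/andP; split.
  apply/bigmax_leqP => u _; apply/bigmax_leqP => v _.
  wlog le_uv : u v / u <= v.
    move=> wlg; case: (leqP u v) => [/wlg//|/ltnW/wlg].
    by rewrite (dist_sym proximity_connected).
  have le_vm : pos v <= m by have := @pos_bounds v n; have := ltn_ord v; lia.
  have [|p [pth <- sz]] := @proximity_path d.-1 u v le_uv.
    by rewrite prednK //; lia.
  by apply: leq_trans (dist_le_size pth) _; rewrite prednK in sz.
have := dist_le_diameter G ord0 ord_max.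
have [p [/pos_path + lst <-]] :=
  dist_path (connectedP _ proximity_connected ord0 ord_max).
by rewrite lst /= pos0; nia.
Qed.

(** A vertex in the interior of the line has a neighbour as far as possible on
    each side; those two are more than [r] apart because the line is longer
    than [r]. At an end all neighbours lie on one side, within [r]. *)
Lemma proximity_num_simplicial : num_simplicial G =
  #|[set v : 'I_n.+1 | pos v == 0]| + #|[set v : 'I_n.+1 | pos v == m]|.
Proof.
have disj : [set v : 'I_n.+1 | pos v == 0] :&: [set v : 'I_n.+1 | pos v == m] = set0.
  by apply/setP => v; rewrite !inE; apply/negP; lia.
rewrite -cardsUI disj cards0 addn0; apply: eq_card => v; rewrite !inE.
have le_vm : pos v <= m by have := @pos_bounds v n; have := ltn_ord v; lia.
apply/simplicialP/orP => [simp | ends x y /and3P[_ ? ?] /and3P[_ ? ?] nxy].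
  have [v0|] := eqVneq (pos v) 0; first by left.
  have [vm|] := eqVneq (pos v) m; first by right.
  move=> nvm nv0.
  have [|a aE] := @pos_onto (pos v - r); first by lia.
  have [|b bE] := @pos_onto (minn (pos v + r) m); first by lia.
  have := simp a b; rewrite /= /proximity /= -!val_eqE /=.
  have nva : v != a :> nat by apply/eqP => e; rewrite -e in aE; lia.
  have nvb : v != b :> nat by apply/eqP => e; rewrite -e in bE; lia.
  have nab : a != b :> nat by apply/eqP => e; rewrite e in aE; lia.
  by rewrite nva nvb nab aE bE /=; lia.
have le_pos w : pos w <= m by have := @pos_bounds w n; have := ltn_ord w; lia.
have := le_pos x; have := le_pos y.
by rewrite /= /proximity /= nxy; case: ends => /eqP; lia.
Qed.

(** Removing the positions [1], ..., [r] cuts off position [0]. Conversely the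
    [r] vertices following [x] are all adjacent to [x], so fewer than [r]
    deletions leave one of them for the next step towards [y]. *)
Lemma proximity_connectivity : #|[set v : 'I_n.+1 | 0 < pos v <= r]| = r ->
  vertex_connectivity G = r.
Proof.
move=> card_r; apply/eqP; rewrite eqn_leq; apply/andP; split.
  rewrite -[X in _ <= X]card_r; apply: (@connectivity_le _ _ _ ord0 ord_max).
  - by rewrite inE /= pos0.
  - by rewrite inE /=; lia.
  apply/negP => /connectP[p pth lst].
  have : pos (last (ord0 : 'I_n.+1) p) = 0.
    have : pos (ord0 : 'I_n.+1) = 0 by [].
    elim: p (ord0 : 'I_n.+1) pth {lst} => //= v p IH u /andP[uv pth] u0.
    apply: IH pth _; move: uv; rewrite /induced /= !inE.
    by case/and3P=> _ nv /and3P[_ _]; move: nv; rewrite u0; lia.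
  by rewrite -lst /=; lia.
apply: le_connectivity => [|S x y lt_S xS yS].
  by rewrite card_ord; have := pos_bounds (leq0n n); rewrite pos0; lia.
wlog le_xy : x y xS yS / x <= y.
  have cs : connect_sym (induced G (~: S)).
    apply: sym_connect_sym => a b.
    by rewrite /induced /= proximity_sym andbCA.
  by move=> wlg; case: (leqP x y) => [/wlg|/ltnW/wlg]; [|rewrite cs]; apply.
have [k] := ubnP (y - x); elim: k x xS le_xy => // k IH x xS le_xy le_k.
have [->|nxy] := eqVneq x y; first exact: connect0.
have [near|far] := leqP (pos y) (pos x + r).
  apply: connect1; rewrite /induced /= !inE xS yS /proximity /= nxy.
  by have := pos_bounds le_xy; lia.
have bxy := pos_bounds le_xy.
pose W := [set w : 'I_n.+1 | x < w <= x + r].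
have cardW : #|W| = r.
  rewrite (card_ord_interval (a := x.+1) (b := (x + r).+1)); first by lia.
    by have := ltn_ord y; lia.
  by move=> v; rewrite inE ltnS.
have [w] : exists w, w \in W :\: S.
  by apply/card_gt0P; have := subset_leq_card (subsetIr W S); rewrite cardsD; lia.
rewrite !inE => /andP[wS /andP[lt_xw le_w]].
apply: connect_trans (IH w wS _ _); [|lia|lia].
apply: connect1; rewrite /induced /= !inE xS wS /proximity /=.
have := @pos_bounds x w; have : x != w by rewrite -val_eqE /=; lia.
by move=> -> /=; lia.
Qed.

Lemma proximity_not_complete : ~~ complete G.
Proof.
apply/forallPn; exists ord0; apply/forallPn; exists ord_max.
rewrite negb_imply /= /proximity /= pos0 -val_eqE /=.
have n_gt0 : 0 != n by apply: contraTneq r_lt => <-; rewrite pos0.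
by rewrite n_gt0; lia.
Qed.

End Proximity.

(** * A dominating vertex joined to a star and an isolated vertex *)

Section DominatedStar.

Variable n : nat.

(** Vertex [0] dominates, [1] is the centre of a star with leaves
    [2], ..., [n.-1], and [n] is adjacent to [0] only. *)
Definition dominated_star : rel 'I_n.+1 :=
  [rel u v : 'I_n.+1 | (u != v) &&
     ((minn u v == 0) || (minn u v == 1) && (maxn u v < n))].

Lemma dominated_star_sym : symmetric dominated_star.
Proof. by move=> u v; rewrite /dominated_star /= eq_sym minnC maxnC. Qed.

Lemma dominated_star_irrefl : irreflexive dominated_star.
Proof. by move=> u; rewrite /dominated_star /= eqxx. Qed.

Definition dominated_star_graph :=
  SGraph dominated_star_sym dominated_star_irrefl.

Local Notation G := dominated_star_graph.

Hypothesis n_ge4 : 4 <= n.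

Lemma dominated_star0 (v : 'I_n.+1) : v != ord0 -> G ord0 v.
Proof. by move=> nv; rewrite /= /dominated_star /= eq_sym nv min0n. Qed.

Lemma dominated_star_connected : connected G.
Proof.
apply/connectedP => u v.
have from0 w : connect G ord0 w.
  have [->|/dominated_star0 e] := eqVneq w ord0; first exact: connect0.
  exact: connect1.
have cs : connect_sym G by apply: sym_connect_sym; exact: dominated_star_sym.
by apply: connect_trans (from0 v); rewrite cs.
Qed.

Let one : 'I_n.+1 := inord 1.

Lemma one_val : one = 1 :> nat.
Proof. by rewrite inordK; lia. Qed.

Lemma dominated_star_not_complete : ~~ complete G.
Proof.
apply/forallPn; exists one; apply/forallPn; exists ord_max.
by rewrite negb_imply /= /dominated_star /= -val_eqE /= one_val; lia.
Qed.

Lemma dominated_star_diameter : diameter G = 2.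
Proof.
have conn := dominated_star_connected.
apply/eqP; rewrite eqn_leq (diameter_ge2 conn dominated_star_not_complete) andbT.
apply/bigmax_leqP => u _; apply/bigmax_leqP => v _.
have dist0 w : dist G ord0 w <= 1.
  have [->|/dominated_star0 e] := eqVneq w ord0; first by rewrite distxx.
  by rewrite -(distxx G ord0); exact: dist_adj e.
have [->|/dominated_star0 e] := eqVneq v ord0.
  by rewrite (dist_sym conn) ltnW // ltnS dist0.
by apply: leq_trans (dist_adj conn u e) _; rewrite ltnS (dist_sym conn).
Qed.

(** As [4 <= n], the vertices [2] and [3] are leaves of the star, hence
    nonadjacent neighbours of both [0] and [1]. All neighbours of any other
    vertex are among [0] and [1], which are adjacent. *)
Lemma dominated_star_num_simplicial : num_simplicial G = n.-1.
Proof.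
rewrite /num_simplicial (card_ord_interval (a := 2) (leqnn n.+1)); first by lia.
move=> v; rewrite inE ltn_ord andbT.
apply/simplicialP/idP => [simp | v_ge2 x y].
  rewrite leqNgt; apply/negP => v_lt2.
  have vals k : k <= n -> (inord k : 'I_n.+1) = k :> nat.
    by move=> le_kn; rewrite inordK.
  have := simp (inord 2) (inord 3).
  by rewrite /= /dominated_star /= -!val_eqE /= !vals; lia.
by rewrite /= /dominated_star /= -!val_eqE /=; lia.
Qed.

Lemma dominated_star_connectivity : vertex_connectivity G = 1.
Proof.
apply/eqP; rewrite eqn_leq; apply/andP; split.
  rewrite -(cards1 (ord0 : 'I_n.+1)).
  apply: (@connectivity_le _ _ _ ord_max one).
  - by rewrite inE -val_eqE /=; lia.
  - by rewrite inE -val_eqE /= one_val.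
  apply/negP => /connectP[[_ /(congr1 val)|z p]].
    by rewrite /= one_val; lia.
  rewrite /induced /= /dominated_star /= !inE -!val_eqE /=.
  by have := ltn_ord z; lia.
apply: le_connectivity => [|S x y]; first by rewrite card_ord.
rewrite ltnS leqn0 cards_eq0 => /eqP-> _ _; rewrite setC0.
have /forall_inP/(_ x (in_setT x))/forall_inP := dominated_star_connected.
by apply; rewrite in_setT.
Qed.

End DominatedStar.

(** * Realization of the parameters *)

(** There are [f.-1] vertices at position [0] and one at each of the positions
    [1], ..., [d + kappa]. The constraint on kappa and d says exactly that
    kappa (d - 1) < d + kappa, which keeps the diameter from dropping
    below d. *)
Lemma proximity_realization n kappa f d : 2 <= kappa -> 2 <= f ->
    (kappa.-1 * (d - 2) <= 1) -> 2 <= d -> d + f + kappa = n.+2 ->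
  exists G : sgraph 'I_n.+1,
    [/\ connected G, ~~ complete G, num_simplicial G = f,
        diameter G = d & vertex_connectivity G = kappa].
Proof.
move=> k2 f2 small d2 sumE.
pose pos v := v - (f - 2).
have pos0 : pos 0 = 0 by [].
have step v : pos v <= pos v.+1 <= (pos v).+1 by rewrite /pos; lia.
have k0 : 0 < kappa by lia.
have mE : pos n = d + kappa by rewrite /pos; lia.
have lt_m : kappa < pos n by lia.
exists (proximity_graph n kappa pos); split.
- exact: proximity_connected.
- exact: proximity_not_complete.
- rewrite proximity_num_simplicial //.
  rewrite (card_ord_interval (a := 0) (b := f.-1)); first last.
  + by move=> v; rewrite inE /pos; have := ltn_ord v; lia.
  + by lia.
  rewrite (card_ord_interval (a := n) (leqnn n.+1)); first by lia.
  by move=> v; rewrite inE mE /pos; have := ltn_ord v; lia.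
- by apply: proximity_diameter => //; [lia | rewrite mE; nia].
- apply: proximity_connectivity => //.
  rewrite (card_ord_interval (a := f.-1) (b := f.-1 + kappa)); [lia|lia|].
  by move=> v; rewrite inE /pos; have := ltn_ord v; lia.
Qed.

(** Same arrangement with [r = 1], except that position [d.-1] is occupied
    twice; as [d >= 3], position [1] is still a single vertex. *)
Lemma proximity_realization_cutvertex n f d : 2 <= f -> 3 <= d -> d + f = n.+1 ->
  exists G : sgraph 'I_n.+1,
    [/\ connected G, ~~ complete G, num_simplicial G = f,
        diameter G = d & vertex_connectivity G = 1].
Proof.
move=> f2 d3 sumE.
pose pos v := v - (f - 2) - (n.-1 <= v).
have pos0 : pos 0 = 0 by [].
have step v : pos v <= pos v.+1 <= (pos v).+1 by rewrite /pos; lia.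
have mE : pos n = d by rewrite /pos; lia.
have lt_m : 1 < pos n by lia.
exists (proximity_graph n 1 pos); split.
- exact: proximity_connected.
- exact: proximity_not_complete.
- rewrite proximity_num_simplicial //.
  rewrite (card_ord_interval (a := 0) (b := f.-1)); first last.
  + by move=> v; rewrite inE /pos; have := ltn_ord v; lia.
  + by lia.
  rewrite (card_ord_interval (a := n) (leqnn n.+1)); first by lia.
  by move=> v; rewrite inE mE /pos; have := ltn_ord v; lia.
- by apply: proximity_diameter => //; [lia | rewrite mE; lia].
- apply: proximity_connectivity => //.
  rewrite (card_ord_interval (a := f.-1) (b := f)); [lia|lia|].
  by move=> v; rewrite inE /pos; have := ltn_ord v; lia.
Qed.

Theorem theorem3p3 (n kappa f d : nat) (n_ge5 : 5 <= n)
    (kappa_gt0 : 0 < kappa) (f_gt0 : 0 < f) (d_gt0 : 0 < d)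
    (sum_eq : d + f + 1 = n + 2 - kappa) :
  (exists G : sgraph 'I_n,
      [/\ connected G, ~~ complete G, num_simplicial G = f,
          diameter G = d & vertex_connectivity G = kappa])
  <->
  [\/ [/\ kappa = 1, 2 <= f & 2 <= d],
      [/\ kappa = 2, 2 <= f & d = 2 \/ d = 3]
    | [/\ 3 <= kappa, 2 <= f & d = 2]].
Proof.
split=> [[G [conn ncomp fE dE kE]] | conds].
  have d2 : 2 <= d by rewrite -dE diameter_ge2.
  have := @extremal_parameters _ G conn ncomp.
  rewrite fE dE kE card_ord => /(_ kappa_gt0 f_gt0)[|f2 small]; first by lia.
  have [k1|[k2|k3]] : kappa = 1 \/ kappa = 2 \/ 3 <= kappa by lia.
  - by constructor 1.
  - by constructor 2; split=> //; move: small; rewrite k2; lia.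
  - by constructor 3; split=> //; nia.
have [f2 d2 small] : [/\ 2 <= f, 2 <= d & kappa.-1 * (d - 2) <= 1].
  by case: conds => [[-> ? ?]|[-> ? []->]|[_ ? ->]]; rewrite ?muln0; split.
case: n n_ge5 sum_eq => // n n_ge5 sum_eq.
have [k2|k1] := leqP 2 kappa; first by apply: proximity_realization => //; lia.
have -> : kappa = 1 by lia.
have [d3|d_lt3] := leqP 3 d.
  by apply: proximity_realization_cutvertex => //; lia.
have n4 : 4 <= n by lia.
exists (dominated_star_graph n); split.
- exact: dominated_star_connected.
- exact: dominated_star_not_complete.
- by rewrite dominated_star_num_simplicial; lia.
- by rewrite dominated_star_diameter; lia.
- exact: dominated_star_connectivity.
Qed.
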